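(* Let $\gamma\in(0,\infty)$ and let $H$ be a probability distribution supported on a compact subset of $(0,\infty)$ (bounded away from $0$ and infinity); let $T$ denote a random variable with distribution $H$. For $\alpha>0$ let $\lambda^*=\gamma/\alpha^2$ and let $$R^*(H,\alpha^2,\gamma)=\frac{1}{\lambda^*v(-\lambda^* )}$$ be the limiting predictive risk of optimally tuned ridge regression, with $v$ the companion Stieltjes transform associated with $(H,\gamma)$. Then: (Weak signal) $\lim_{\alpha^2\to0}R^*(H,\alpha^2,\gamma)=1$ and $\lim_{\alpha^2\to0}\dfrac{R^*(H,\alpha^2,\gamma)-1}{\alpha^2}=\mathbb{E}_H[T]$. (Strong signal, $\gamma<1$) $\lim_{\alpha^2\to\infty}R^*(H,\alpha^2,\gamma)=\dfrac{1}{1-\gamma}$. (Strong signal, $\gamma>1$) $\lim_{\alpha^2\to\infty}\alpha^{-2}R^*(H,\alpha^2,\gamma)=\dfrac{1}{\gamma\,v(0)}$, where $v(0)$ is the unique $c>0$ for which $\dfrac1\gamma=\displaystyle\int_0^\infty\frac{tc}{1+tc}\,dH(t)$. (Strong signal, $\gamma=1$) $\lim_{\alpha^2\to\infty}\alpha^{-1}R^*(H,\alpha^2,\gamma)=\dfrac{1}{\sqrt{\mathbb{E}_H[T^{-1}]}}$.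
   Context: Companion Stieltjes transform. Let $\Sigma=\Sigma_p$ be deterministic positive semidefinite $p\times p$ matrices whose spectral distributions (c.d.f.s of eigenvalues) converge weakly to $H$, let $X=Z\Sigma^{1/2}$ with $Z$ an $n\times p$ matrix with i.i.d. entries of mean $0$ and variance $1$, and let $n,p\to\infty$ with $p/n\to\gamma$. The spectral distribution of $n^{-1}X^\top X$ converges weakly almost surely to a deterministic distribution $F$ depending only on $H$ and $\gamma$, and that of $n^{-1}XX^\top$ to $\underline F=\gamma F+(1-\gamma)\delta_0$. The companion Stieltjes transform is $v(z)=\int\frac{d\underline F(l)}{l-z}$ for $z\in\mathbb{C}\setminus[0,\infty)$; it satisfies the Silverstein equation $-\frac1{v(z)}=z-\gamma\int\frac{t\,dH(t)}{1+tv(z)}$, and for $z=-\lambda$ with $\lambda>0$ the number $v(-\lambda)$ is positive. *)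

(* Defs.v *)
From HB Require Import structures.
From mathcomp Require Import all_boot all_order all_algebra.
From mathcomp Require Import all_classical all_reals all_analysis.
From mathcomp Require Import complex.

Set Implicit Arguments.
Unset Strict Implicit.
Unset Printing Implicit Defensive.

Import Order.TTheory GRing.Theory Num.Theory.
Import numFieldNormedType.Exports.

Local Open Scope classical_set_scope.
Local Open Scope ring_scope.
Local Open Scope complex_scope.

Definition dist_fun (R : realType) (mu : probability (measurableTypeR R) R)
  (x : R) : R := fine (mu `]-oo, x]%classic).

Definition weak_cvg (R : realType) (G : nat -> R -> R)
    (mu : probability (measurableTypeR R) R) : Prop :=
  forall x : R, {for x, continuous (dist_fun mu)} ->
    G k x @[k --> \oo] --> dist_fun mu x.

(* The eigenvalues of A listed with multiplicity: the list is determined up to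
   order, and exists whenever the characteristic polynomial splits over R, in
   particular for symmetric A (the only case used). *)
Definition eigenvalues (R : realType) (m : nat) (A : 'M[R]_m) : seq R :=
  xget [::] [set s : seq R | char_poly A = \prod_(a <- s) ('X - a%:P)].

Definition spectral_cdf (R : realType) (m : nat) (A : 'M[R]_m) (x : R) : R :=
  (count (fun a => a <= x) (eigenvalues A))%:R / m%:R.

Definition psdmx (R : realType) (m : nat) (A : 'M[R]_m) : Prop :=
  A^T = A /\ forall u : 'rV[R]_m, 0 <= (u *m A *m u^T) 0 0.

Definition psd_sqrtmx (R : realType) (m : nat) (A : 'M[R]_m) : 'M[R]_m :=
  xget 0 [set B : 'M[R]_m | psdmx B /\ B *m B = A].

Definition mutually_independent (R : realType) (d : measure_display)
    (Omega : measurableType d) (P : probability Omega R)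
    (I : finType) (X : I -> {RV P >-> R}) : Prop :=
  forall (J : {set I}) (A : I -> set R), (forall i, measurable (A i)) ->
    P [set w | forall i, i \in J -> A i (X i w)] =
    (\prod_(i in J) P (X i @^-1` A i))%E.

(* The k-th matrix Z_k has size n k x p k. The entries of each Z_k are
   independent, and all entries, of all the Z_k, have the same law; nothing is
   assumed on the joint law of Z_k and Z_l for k <> l. *)
Record sample_covariance_model (R : realType) (d : measure_display)
    (Omega : measurableType d) (P : probability Omega R)
    (gamma : R) (H : probability (measurableTypeR R) R) (n p : nat -> nat)
    (Sigma : forall k, 'M[R]_(p k))
    (Z : forall k, 'I_(n k) -> 'I_(p k) -> {RV P >-> R}) : Prop := {
  scm_n : n k @[k --> \oo] --> \oo ;
  scm_p : p k @[k --> \oo] --> \oo ;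
  scm_ratio : ((p k)%:R / (n k)%:R : R) @[k --> \oo] --> gamma ;
  scm_psd : forall k, psdmx (Sigma k) ;
  scm_Sigma : weak_cvg (fun k => spectral_cdf (Sigma k)) H ;
  scm_indep : forall k, mutually_independent
    (fun ij : 'I_(n k) * 'I_(p k) => Z k ij.1 ij.2) ;
  scm_ident : forall k i j k' i' j' (A : set R), measurable A ->
    distribution P (Z k i j) A = distribution P (Z k' i' j') A ;
  scm_mean : forall k i j, ('E_P[(Z k i j)] = 0)%E ;
  scm_var : forall k i j, ('V_P[(Z k i j)] = 1)%E
}.

(* X = Z Sigma^(1/2), where z i j are the entries of Z *)
Definition data_mx (R : realType) (m q : nat) (z : 'I_m -> 'I_q -> R)
    (S : 'M[R]_q) : 'M[R]_(m, q) :=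
  (\matrix_(i, j) z i j) *m psd_sqrtmx S.

Definition sample_covariance (R : realType) (m q : nat) (X : 'M[R]_(m, q)) :
  'M[R]_q := m%:R^-1 *: (X^T *m X).

Definition limiting_spectral_distribution (R : realType) (d : measure_display)
    (Omega : measurableType d) (P : probability Omega R) (n p : nat -> nat)
    (Sigma : forall k, 'M[R]_(p k))
    (Z : forall k, 'I_(n k) -> 'I_(p k) -> {RV P >-> R})
    (F : probability (measurableTypeR R) R) : Prop :=
  {ae P, forall w, weak_cvg (fun k => spectral_cdf (sample_covariance
    (data_mx (fun i j => Z k i j w) (Sigma k)))) F}.

(* Fbar = gamma F + (1 - gamma) delta_0; the second weight is negative when
   gamma > 1. *)
Definition companion_distribution (R : realType) (gamma : R)
    (F Fbar : probability (measurableTypeR R) R) : Prop :=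
  forall A : set (measurableTypeR R), measurable A ->
    Fbar A = (gamma%:E * F A + (1 - gamma)%:E * \d_(0%R : R) A)%E.

Definition Cintegral (R : realType) (mu : probability (measurableTypeR R) R)
    (f : R -> R[i]) : R[i] :=
  (\int[mu]_x complex.Re (f x)) +i* (\int[mu]_x complex.Im (f x)).

Definition stieltjes (R : realType) (mu : probability (measurableTypeR R) R)
  (z : R[i]) : R[i] := Cintegral mu (fun l => (l%:C - z)^-1).

(* z lies in C minus [0, +oo) *)
Definition off_half_line (R : realType) (z : R[i]) : Prop :=
  forall x : R, 0 <= x -> z <> x%:C.

Definition silverstein_equation (R : realType) (gamma : R)
    (H : probability (measurableTypeR R) R) (v : R[i] -> R[i]) : Prop :=
  forall z : R[i], off_half_line z ->
    - (v z)^-1 = z - gamma%:C * Cintegral H (fun t => t%:C / (1 + t%:C * v z)).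

(* The limiting risk as a function of s = alpha ^+ 2. The complex number
   v (- lambda) is real, so that taking the real part only changes its type. *)
Definition optimal_risk (R : realType) (gamma : R) (v : R[i] -> R[i])
    (s : R) : R :=
  let lambda := gamma / s in
  complex.Re ((lambda%:C * v (- lambda)%:C)^-1).

(* Main.v *)
Require Import Defs.
From HB Require Import structures.
From mathcomp Require Import all_boot all_order all_algebra.
From mathcomp Require Import all_classical all_reals all_analysis.
From mathcomp Require Import measurable_realfun complex ring lra.

Import Order.TTheory GRing.Theory Num.Theory.
Import numFieldNormedType.Exports.

Local Open Scope classical_set_scope.
Local Open Scope ring_scope.

(** Write V(s) for the companion Stieltjes transform at z = - gamma / s, where
    s stands for alpha ^ 2, so that the risk is R(s) = 1 / ((gamma / s) V(s)).

    V(s) is real because z is, and it is positive because of the random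
    matrices.  A sample covariance matrix is a Gram matrix, so its spectral c.d.f. vanishes
    on the negative half line.  The c.d.f. of F is a limit of such functions at
    its continuity points, and these are dense because a monotone function has
    countably many jumps; hence F, and with it the companion distribution, is
    carried by [0, +oo) ([lsd_lt0], [companion_half_line]), where
    l |-> 1 / (l + lambda) is positive and bounded.

    Everything else follows from the Silverstein equation on the negative half
    line.  Let H be carried by [a, b] with a > 0, and put
      B(x) = int dH(t) / (1 + t x)  ([resolvent]),
      A(x) = int t dH(t) / (1 + t x)  ([weighted_resolvent]);
    pointwise addition gives x A(x) + B(x) = 1.  The equation then takes the
    two forms
      R(s) = 1 + s A(V(s))  and  1 / R(s) = 1 - gamma + gamma B(V(s)).

    - As s -> 0, V(s) <= s / gamma tends to 0, so that
      (R(s) - 1) / s = A(V(s)) tends to A(0) = E T.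
    - If gamma < 1, the second form bounds V(s) below by a multiple of s, so
      that B(V(s)) <= 1 / (a V(s)) tends to 0 and 1 / R(s) to 1 - gamma.
    - If gamma > 1, there is v0 > 0 with 1 - gamma + gamma B(v0) = 0.  As
      1 / R(s) > 0 and B is decreasing, V(s) < v0; the decrease of B between
      V(s) and v0 is V(s) / s <= v0 / s, while the slope of B is
      bounded away from 0, so that V(s) tends to v0, and R(s) / s is
      1 / (gamma V(s)).
    - If gamma = 1, the second form reads V(s) / s = B(V(s)).  As
      B(x) >= 1 / (1 + b x), V(s) tends to infinity, and then
      V(s) ^ 2 / s = V(s) B(V(s)) tends to E [1 / T], while
      (R(s) / sqrt s) ^ 2 is the inverse of V(s) ^ 2 / s.

    Each of these convergences is an explicit error bound ([cvg_dist_le]). *)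

Set Implicit Arguments.
Unset Strict Implicit.

(** * Nonnegativity of the limiting spectrum *)

Lemma gram_eigenvalue_ge0 (R : realType) (m q : nat) (X : 'M[R]_(m, q))
    (a : R) :
  eigenvalue (X^T *m X) a -> 0 <= a.
Proof.
move=> /eigenvalueP[u uXX u_neq0].
have sq_ge0 k (w : 'rV[R]_k) : 0 <= (w *m w^T) 0 0.
  by rewrite mxE sumr_ge0// => i _; rewrite mxE -expr2 sqr_ge0.
have uu_gt0 : 0 < (u *m u^T) 0 0.
  rewrite lt_neqAle sq_ge0 andbT eq_sym; apply: contra u_neq0.
  rewrite mxE psumr_eq0; last by move=> i _; rewrite mxE -expr2 sqr_ge0.
  move=> /allP u0; apply/eqP/rowP => i; rewrite mxE.
  have /eqP := u0 i (mem_index_enum _); rewrite mxE -expr2 => /eqP.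
  by rewrite sqrf_eq0 => /eqP.
have : 0 <= (u *m X^T *m (u *m X^T)^T) 0 0 by exact: sq_ge0.
rewrite trmx_mul trmxK mulmxA -(mulmxA u) uXX -scalemxAl mxE.
by rewrite pmulr_lge0.
Qed.

(** A listed eigenvalue is a root of the characteristic polynomial, hence an
    eigenvalue of a Gram matrix; if no list splits that polynomial, the list
    defaults to the empty one, which counts nothing. *)
Lemma sample_covariance_cdf_lt0 (R : realType) (m q : nat)
    (X : 'M[R]_(m, q)) (x : R) :
  x < 0 -> spectral_cdf (sample_covariance X) x = 0.
Proof.
move=> x_lt0; rewrite /spectral_cdf /eigenvalues.
case: xgetP => [s _ /= chars|_]; last by rewrite /= mul0r.
suff -> : count (fun a => a <= x) s = 0%N by rewrite mul0r.
apply/eqP; rewrite -leqn0 leqNgt -has_count; apply/hasPn => a a_s.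
rewrite -ltNge (lt_le_trans x_lt0)//.
have : eigenvalue (sample_covariance X) a.
  by rewrite eigenvalue_root_char chars root_prod_XsubC.
have -> : sample_covariance X =
    (Num.sqrt m%:R^-1 *: X)^T *m (Num.sqrt m%:R^-1 *: X).
  rewrite /sample_covariance (linearZ_LR (@trmx R m q)).
  rewrite -scalemxAl -scalemxAr scalerA.
  by rewrite -expr2 sqr_sqrtr// invr_ge0.
exact: gram_eigenvalue_ge0.
Qed.

(** The discontinuities in the interval form a countable set, hence a null set
    for the Lebesgue measure, while the interval has positive measure. *)
Lemma nondecreasing_continuity_point (R : realType) (f : R -> R) (a b : R) :
  {homo f : x y / x <= y} -> a < b ->
  exists x, a < x < b /\ {for x, continuous f}.
Proof.
move=> ndf ab.
have ndab : {in `[a, b]%R &, {homo f : x y / x <= y}}.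
  by move=> x y _ _; exact: ndf.
have cD := discontinuity_countable ndab.
have D0 := countable_lebesgue_measure0 cD.
have [x [xab xD]] : exists x, a < x < b /\ ~ discontinuity f x.
  apply: contrapT => /forallNP H.
  have D_itv :
      [set x | (x \in `]a, b[%R) /\ discontinuity f x] = `]a, b[%classic.
    apply/seteqP; split => x /=; first by case.
    move=> xab; split => //; apply: contrapT => xD.
    by apply: (H x); split => //; move: xab; rewrite in_itv.
  move: D0; rewrite D_itv lebesgue_measure_itv/= lte_fin ab -EFinB => -[].
  by move/eqP; rewrite subr_eq0 gt_eqF.
exists x; split=> //.
have cvl : cvg (f y @[y --> x^'-]).
  apply: nondecreasing_at_left_is_cvgr.
    by near=> y; move=> s t _ _; exact: ndf.
  near=> y; exists (f x) => _ [t /= + <-]; rewrite in_itv/= => /andP[_ /ltW].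
  exact: ndf.
have cvr : cvg (f y @[y --> x^'+]).
  apply: nondecreasing_at_right_is_cvgr.
    by near=> y; move=> s t _ _; exact: ndf.
  near=> y; exists (f x) => _ [t /= + <-]; rewrite in_itv/= => /andP[/ltW + _].
  exact: ndf.
have lr : lim (f y @[y --> x^'-]) = lim (f y @[y --> x^'+]).
  by apply: contrapT => /eqP lr; apply: xD.
have lx : lim (f y @[y --> x^'-]) <= f x.
  by apply: limr_le => //; near=> y; apply: ndf.
have xr : f x <= lim (f y @[y --> x^'+]).
  by apply: limr_ge => //; near=> y; apply: ndf.
have fl : lim (f y @[y --> x^'-]) = f x.
  by apply/eqP; rewrite eq_le lx lr xr.
apply/continuous_withinNx; apply: (@cvg_at_right_left_dnbhs R R^o f x (f x)).
  by rewrite -fl lr.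
by rewrite -fl.
Unshelve. all: end_near. Qed.

(** The almost sure event has probability one, so it contains some outcome, and
    one outcome is enough: along it the c.d.f. of F at a negative continuity
    point is a limit of zeros.  Such points accumulate at 0 from the left. *)
Lemma lsd_lt0 (R : realType) (d : measure_display)
    (Omega : measurableType d) (P : probability Omega R) (n p : nat -> nat)
    (Sigma : forall k, 'M[R]_(p k))
    (Z : forall k, 'I_(n k) -> 'I_(p k) -> {RV P >-> R})
    (F : probability (measurableTypeR R) R) :
  limiting_spectral_distribution Sigma Z F -> F `]-oo, 0[%classic = 0%E.
Proof.
move=> [N [mN N0 Nsub]].
have [w] : exists w, ~ N w.
  apply: contrapT => /forallNP allN.
  have NT : N = setT by apply/seteqP; split => // w _; exact: contrapT (allN w).
  by move: N0; rewrite NT probability_setT => /eqP; rewrite onee_eq0.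
move=> Nw.
have {Nsub Nw} Fw : weak_cvg (fun k => spectral_cdf (sample_covariance
    (data_mx (fun i j => Z k i j w) (Sigma k)))) F.
  by apply: contrapT => /Nsub.
have F_homo : {homo dist_fun F : x y / x <= y}.
  move=> x y xy; rewrite /dist_fun fine_le ?fin_num_measure//.
  by rewrite le_measure ?inE//; apply: subset_itvl; rewrite bnd_simp.
have F0 x : x < 0 -> F `]-oo, x]%classic = 0%E.
  move=> x_lt0.
  have [y [/andP[xy y_lt0] cy]] := nondecreasing_continuity_point F_homo x_lt0.
  have Fy : dist_fun F y = 0.
    have /cvg_lim <- // := Fw y cy.
    rewrite (_ : (fun k => _) = cst 0) ?lim_cst//.
    by apply/funext => k; rewrite sample_covariance_cdf_lt0.
  have := F_homo _ _ (ltW xy); rewrite Fy /dist_fun => Fx.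
  rewrite -[LHS]fineK ?fin_num_measure//; congr EFin.
  by apply/eqP; rewrite eq_le Fx fine_ge0.
have -> : `]-oo, 0[%classic = \bigcup_k `]-oo, - k.+1%:R^-1]%classic :> set R.
  apply/seteqP; split => [x|x [k _]] /=; rewrite !in_itv/=.
    move=> x_lt0; have nx : 0 < - x by rewrite oppr_gt0.
    have [k kx] := ltr_add_invr nx.
    exists k => //=; rewrite in_itv/= lerNr ltW//.
    by move: kx; rewrite add0r.
  by move/le_lt_trans; apply; rewrite oppr_lt0 invr_gt0.
apply: measure_negligible.
  by apply: bigcupT_measurable => k; exact: measurable_itv.
apply: negligible_bigcup => k; apply/negligibleP; first exact: measurable_itv.
by apply: F0; rewrite oppr_lt0 invr_gt0.
Qed.

(** * Integration against a concentrated law *)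

(** The inversion is continuous away from 0, and every function is measurable
    on the singleton of 0. *)
Lemma measurable_fun_inverse (R : realType) (d : measure_display)
    (T : measurableType d) (f : T -> R) :
  measurable_fun setT f -> measurable_fun setT (fun x => (f x)^-1).
Proof.
move=> mf; apply: (@measurableT_comp _ _ _ _ _ _ (fun x : R => x^-1)) => //.
have mZ : measurable ([set 0] : set R) by exact: measurable_set1.
have -> : setT = [set 0 : R] `|` ~` [set 0] by rewrite setUv.
apply/measurable_funU => //; first exact: measurableC.
split.
  exact: measurable_fun_set1.
apply: open_continuous_measurable_fun.
  by rewrite openC; exact: closed_eq.
by move=> x /set_mem /= /eqP x0; exact: inv_continuous.
Qed.

(** For a law concentrated on D, bounds that hold only on D suffice for
    integrability over the whole space and for comparing integrals. *)
Section concentrated.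
Context (d : measure_display) (T : measurableType d) (R : realType).
Context (mu : probability T R) (D : set T) (mD : measurable D).
Context (muD : mu D = 1%E).
Implicit Types f g : T -> R.

Let muDC : mu (~` D) = 0%E.
Proof. by rewrite probability_setC// muD subee. Qed.

Lemma concentrated_integrable f (M : R) : measurable_fun setT f ->
  (forall t, D t -> `|f t| <= M) -> mu.-integrable setT (EFin \o f).
Proof.
move=> mf fM; apply/(negligible_integrable (measurableC mD) _ _ muDC) => //.
  exact/measurable_EFinP.
rewrite setDE setCK setTI; apply: measurable_bounded_integrable => //.
- by rewrite [X in (X < _)%E]muD ltry.
- exact: measurable_funTS.
- exists M; split; first exact: num_real.
  by move=> x Mx t Dt; apply: le_trans (fM t Dt) _; exact: ltW.
Qed.

Lemma concentrated_Rintegral f (E : set T) (M : R) : measurable_fun setT f ->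
  (forall t, D t -> `|f t| <= M) -> measurable E -> D `<=` E ->
  \int[mu]_(t in E) f t = \int[mu]_(t in D) f t.
Proof.
move=> mf fM mE DE; have fi := concentrated_integrable mf fM.
rewrite /Rintegral; congr fine.
rewrite (negligible_integral (measurableC mD) _ _ muDC)//; last first.
  exact: integrableS fi.
by rewrite setDE setCK; congr (integral _ _ _); apply/setIidPr.
Qed.

Lemma concentrated_integrableD f (M : R) : measurable_fun setT f ->
  (forall t, D t -> `|f t| <= M) -> mu.-integrable D (EFin \o f).
Proof. by move=> mf fM; apply: integrableS (concentrated_integrable mf fM). Qed.

Lemma concentrated_cst (c : R) : \int[mu]_(t in D) c = c.
Proof. by rewrite Rintegral_cst// [X in fine X]muD mulr1. Qed.

Let cst_integrable (c : R) : mu.-integrable D (EFin \o cst c).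
Proof. exact: finite_measure_integrable_cst. Qed.

Lemma concentrated_le f (c : R) : mu.-integrable D (EFin \o f) ->
  (forall t, D t -> f t <= c) -> \int[mu]_(t in D) f t <= c.
Proof.
move=> fi fc; rewrite -[leRHS]concentrated_cst.
by apply: le_Rintegral => //; exact: cst_integrable.
Qed.

Lemma concentrated_ge f (c : R) : mu.-integrable D (EFin \o f) ->
  (forall t, D t -> c <= f t) -> c <= \int[mu]_(t in D) f t.
Proof.
move=> fi fc; rewrite -[leLHS]concentrated_cst.
by apply: le_Rintegral => //; exact: cst_integrable.
Qed.

Lemma concentrated_integrableB f g :
  mu.-integrable D (EFin \o f) -> mu.-integrable D (EFin \o g) ->
  mu.-integrable D (EFin \o (fun t => f t - g t)).
Proof.
move=> fi gi.
rewrite (_ : _ \o _ = (EFin \o f) \- (EFin \o g))%E; first exact: integrableB.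
by apply/funext => t; rewrite /= EFinB.
Qed.

Lemma concentrated_dist f g (e : R) :
  mu.-integrable D (EFin \o f) -> mu.-integrable D (EFin \o g) ->
  (forall t, D t -> `|f t - g t| <= e) ->
  `|\int[mu]_(t in D) f t - \int[mu]_(t in D) g t| <= e.
Proof.
move=> fi gi fge; rewrite -RintegralB//.
have fgi := concentrated_integrableB fi gi.
rewrite ler_norml; apply/andP; split.
  by apply: concentrated_ge => // t /fge; rewrite ler_norml => /andP[].
by apply: concentrated_le => // t /fge; rewrite ler_norml => /andP[].
Qed.

(** A nonnegative function with zero integral vanishes almost everywhere, which
    positivity on a set of mass one forbids. *)
Lemma concentrated_gt0 f (M : R) : measurable_fun setT f ->
  (forall t, D t -> 0 < f t <= M) -> 0 < \int[mu]_(t in D) f t.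
Proof.
move=> mf f0.
have fi : mu.-integrable D (EFin \o f).
  apply: (@concentrated_integrableD _ M) => // t /f0 /andP[ft fM].
  by rewrite gtr0_norm.
rewrite lt_neqAle eq_sym; apply/andP; split; last first.
  by apply: Rintegral_ge0 => t /f0 /andP[/ltW].
apply/eqP => int0.
have mf' : measurable_fun D (EFin \o f) by exact: measurable_int fi.
have : (\int[mu]_(t in D) `|(f t)%:E| = 0)%E.
  rewrite (eq_integral (EFin \o f)); last first.
    by move=> t /set_mem /f0 /andP[/ltW ft _]; rewrite gee0_abs.
  by rewrite -[LHS]fineK ?integrable_fin_num//; congr EFin.
move=> /(ae_eq_integral_abs mu mD mf')[N [mN N0 DN]].
have : (mu D <= mu N)%E.
  rewrite le_measure ?inE// => t Dt; apply: DN => /= /(_ Dt) [ft].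
  by have := f0 t Dt; rewrite ft ltxx.
by rewrite [leLHS]muD N0 lee_fin ler10.
Qed.

End concentrated.

(** * Resolvent means of the population law *)

(** The interval [a, b] with a > 0 carries H; the bounds below are the pointwise
    ones on that interval, integrated. *)
Section resolvent.
Context (R : realType) (H : probability (measurableTypeR R) R) (a b : R).
Context (a_gt0 : 0 < a) (H_ab : H `[a, b]%classic = 1%E).
Implicit Types x y s t : R.

Definition mean (f : R -> R) : R := \int[H]_(t in `[a, b]) f t.
Definition resolvent x : R := mean (fun t => (1 + t * x)^-1).
Definition weighted_resolvent x : R := mean (fun t => t / (1 + t * x)).

Let mab : measurable (`[a, b]%classic : set (measurableTypeR R)).
Proof. exact: measurable_itv. Qed.

Let support t : `[a, b]%classic t -> 0 < a /\ a <= t /\ t <= b.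
Proof. by rewrite /= in_itv/= => /andP[]. Qed.

Lemma support_sup_gt0 : 0 < b.
Proof.
rewrite (lt_le_trans a_gt0)// leNgt; apply/negP => ba.
move: H_ab; rewrite set_itv_ge ?bnd_simp -?ltNge// measure0 => /esym/eqP.
by rewrite onee_eq0.
Qed.

Lemma measurable_resolvent x :
  measurable_fun setT (fun t : R => (1 + t * x)^-1).
Proof.
apply: measurable_fun_inverse.
apply: measurable_funD; first exact: measurable_cst.
by apply: measurable_funM => //; exact: measurable_cst.
Qed.

Lemma measurable_weighted_resolvent x :
  measurable_fun setT (fun t : R => t / (1 + t * x)).
Proof. by apply: measurable_funM => //; exact: measurable_resolvent. Qed.

Lemma denominator_bounds t x : a <= t -> t <= b -> 0 <= x ->
  1 <= 1 + t * x /\ 1 + a * x <= 1 + t * x <= 1 + b * x.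
Proof.
move=> ta tb x0; have a0 := a_gt0; rewrite !lerD2l !ler_wpM2r//; split=> //.
by rewrite lerDl mulr_ge0//; lra.
Qed.

Lemma resolvent_bound t x : `[a, b]%classic t -> 0 <= x ->
  `|(1 + t * x)^-1| <= 1.
Proof.
move=> /support[a0 [ta tb]] x0; have [D1 _] := denominator_bounds ta tb x0.
by rewrite ger0_norm ?invr_ge0 ?invf_le1; lra.
Qed.

Lemma weighted_resolvent_bound t x : `[a, b]%classic t -> 0 <= x ->
  `|t / (1 + t * x)| <= b.
Proof.
move=> tab x0; have [a0 [ta tb]] := support tab.
rewrite normrM -[leRHS]mulr1 ler_pM//; last exact: resolvent_bound.
by rewrite ger0_norm; lra.
Qed.

Lemma inv_bound t : `[a, b]%classic t -> `|t^-1| <= a^-1.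
Proof.
move=> /support[a0 [ta tb]].
by rewrite ger0_norm ?invr_ge0 ?lef_pV2 ?posrE; lra.
Qed.

Let int_id : H.-integrable `[a, b] (EFin \o (fun t : R => t)).
Proof.
apply: (@concentrated_integrableD _ _ _ _ _ mab H_ab _ b) => // t.
move=> /support[a0 [ta tb]].
by rewrite ger0_norm; lra.
Qed.

Let int_inv : H.-integrable `[a, b] (EFin \o (fun t : R => t^-1)).
Proof.
apply: (@concentrated_integrableD _ _ _ _ _ mab H_ab _ a^-1) => //
  [|t /inv_bound//].
exact: measurable_fun_inverse.
Qed.

Let int_resolvent x : 0 <= x ->
  H.-integrable `[a, b] (EFin \o (fun t : R => (1 + t * x)^-1)).
Proof.
move=> x0.
apply: (@concentrated_integrableD _ _ _ _ _ mab H_ab _ 1) => //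
  [|t /resolvent_bound].
  exact: measurable_resolvent.
exact.
Qed.

Let int_weighted x : 0 <= x ->
  H.-integrable `[a, b] (EFin \o (fun t : R => t / (1 + t * x))).
Proof.
move=> x0.
apply: (@concentrated_integrableD _ _ _ _ _ mab H_ab _ b) => //
  [|t /weighted_resolvent_bound].
  exact: measurable_weighted_resolvent.
exact.
Qed.

Lemma support_integrableZ (f : R -> R) (c : R) :
  H.-integrable `[a, b] (EFin \o f) ->
  H.-integrable `[a, b] (EFin \o (fun t : R => c * f t)).
Proof.
move=> fi; rewrite (_ : _ \o _ = (fun t => c%:E * (EFin \o f) t)%E).
  exact: integrableZl.
by apply/funext => t; rewrite /= EFinM.
Qed.

(** The pointwise identity x t / (1 + t x) + 1 / (1 + t x) = 1, integrated. *)
Lemma resolvent_identity x : 0 <= x ->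
  x * weighted_resolvent x + resolvent x = 1.
Proof.
move=> x0; rewrite /weighted_resolvent /resolvent /mean.
rewrite -RintegralZl ?int_weighted//.
rewrite -RintegralD ?int_resolvent ?support_integrableZ ?int_weighted//.
rewrite -[RHS](concentrated_cst mab H_ab); apply: eq_Rintegral => t.
move=> /set_mem/support[a0 [ta tb]]; have [D1 _] := denominator_bounds ta tb x0.
by field; lra.
Qed.

Lemma resolvent_ge x : 0 <= x -> (1 + b * x)^-1 <= resolvent x.
Proof.
move=> x0; apply: concentrated_ge => //; first exact: int_resolvent.
move=> t /support[a0 [ta tb]].
have [D1 /andP[_ D2]] := denominator_bounds ta tb x0.
by rewrite lef_pV2 ?posrE; lra.
Qed.

Lemma resolvent_gt0 x : 0 <= x -> 0 < resolvent x.
Proof.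
move=> x0; apply: lt_le_trans (resolvent_ge x0).
by rewrite invr_gt0 ltr_wpDr// mulr_ge0// ltW// support_sup_gt0.
Qed.

Lemma weighted_resolvent_ge0 x : 0 <= x -> 0 <= weighted_resolvent x.
Proof.
move=> x0; apply: Rintegral_ge0 => t /support[a0 [ta tb]].
by rewrite divr_ge0 ?addr_ge0 ?mulr_ge0//; lra.
Qed.

Lemma resolvent_le x : 0 < x -> resolvent x <= (a * x)^-1.
Proof.
move=> x0; apply: concentrated_le => //; first exact/int_resolvent/ltW.
move=> t /support[a0 [ta tb]].
have [D1 /andP[D2 _]] := denominator_bounds ta tb (ltW x0).
by rewrite lef_pV2 ?posrE ?mulr_gt0; lra.
Qed.

Lemma resolvent_lipschitz x y : 0 <= x -> 0 <= y ->
  `|resolvent x - resolvent y| <= b * `|x - y|.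
Proof.
move=> x0 y0; apply: concentrated_dist => //; try exact: int_resolvent.
move=> t tab; have [a0 [ta tb]] := support tab.
have [Dx _] := denominator_bounds ta tb x0.
have [Dy _] := denominator_bounds ta tb y0.
have -> : (1 + t * x)^-1 - (1 + t * y)^-1 =
    - ((t / (1 + t * x)) * (1 + t * y)^-1 * (x - y)) by field; lra.
rewrite normrN normrM ler_wpM2r// normrM -[leRHS]mulr1 ler_pM//.
  exact: weighted_resolvent_bound.
exact: resolvent_bound.
Qed.

(** A lower bound on the slope of the resolvent mean: the difference of the
    integrands is t (y - x) / ((1 + t x) (1 + t y)).  It yields both strict
    monotonicity and the rate of convergence of the fixed point. *)
Lemma resolvent_decr x y : 0 <= x -> x <= y ->
  a / (1 + b * y) ^+ 2 * (y - x) <= resolvent x - resolvent y.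
Proof.
move=> x0 xy; have y0 : 0 <= y by lra.
rewrite /resolvent /mean -RintegralB ?int_resolvent//.
apply: concentrated_ge => //.
  by apply: concentrated_integrableB => //; exact: int_resolvent.
move=> t /support[a0 [ta tb]].
have [Dx /andP[_ Dxb]] := denominator_bounds ta tb x0.
have [Dy /andP[_ Dyb]] := denominator_bounds ta tb y0.
have -> : (1 + t * x)^-1 - (1 + t * y)^-1 =
    t * ((1 + t * x) * (1 + t * y))^-1 * (y - x) by field; lra.
apply: ler_wpM2r; first by lra.
apply: ler_pM => //; [by lra|by rewrite invr_ge0 sqr_ge0|].
have bxy : b * x <= b * y by rewrite ler_wpM2l//; lra.
rewrite expr2 lef_pV2 ?posrE ?mulr_gt0 ?ler_pM//; lra.
Qed.

Lemma resolvent_mono x y : 0 <= x -> x < y -> resolvent y < resolvent x.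
Proof.
move=> x0 xy; rewrite -subr_gt0.
apply: lt_le_trans (resolvent_decr x0 (ltW xy)).
have b0 := support_sup_gt0; have a0 := a_gt0.
have bD : 0 < 1 + b * y by rewrite ltr_wpDr// mulr_ge0//; lra.
by rewrite mulr_gt0 ?subr_gt0// divr_gt0// exprn_gt0.
Qed.

Lemma resolvent_inj x y :
  0 <= x -> 0 <= y -> resolvent x = resolvent y -> x = y.
Proof.
move=> x0 y0 xy; case: (ltgtP x y) => // /resolvent_mono.
  by move=> /(_ x0); rewrite xy ltxx.
by move=> /(_ y0); rewrite xy ltxx.
Qed.

(** The error term is t ^ 2 x / (1 + t x). *)
Lemma weighted_resolvent_near0 x : 0 <= x ->
  `|weighted_resolvent x - mean id| <= b ^+ 2 * x.
Proof.
move=> x0; apply: concentrated_dist => //; first exact: int_weighted.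
move=> t tab; have [a0 [ta tb]] := support tab.
have [D1 _] := denominator_bounds ta tb x0.
have -> : t / (1 + t * x) - t = - (t * x * (t / (1 + t * x))) by field; lra.
rewrite normrN normrM (_ : b ^+ 2 * x = b * x * b); last by ring.
apply: ler_pM => //; last exact: weighted_resolvent_bound.
by rewrite ger0_norm ?mulr_ge0// ?ler_wpM2r//; lra.
Qed.

(** The error term is 1 / (t (1 + t x)). *)
Lemma resolvent_nearpinfty x : 0 < x ->
  `|x * resolvent x - mean GRing.inv| <= (a ^+ 2 * x)^-1.
Proof.
move=> x0; have x0' := ltW x0.
rewrite /resolvent /mean -RintegralZl ?int_resolvent//.
apply: (@concentrated_dist _ _ _ _ _ mab H_ab (fun t => x * (1 + t * x)^-1)
  (fun t => t^-1)) => //; first exact/support_integrableZ/int_resolvent.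
move=> t tab; have [a0 [ta tb]] := support tab.
have [D1 /andP[Da _]] := denominator_bounds ta tb (ltW x0).
have -> : x * (1 + t * x)^-1 - t^-1 = - (t * (1 + t * x))^-1.
  by field; apply/andP; lra.
have h : 0 <= (t - a) * (t + a) * x by rewrite !mulr_ge0//; lra.
have h' : a ^+ 2 * x <= t * (1 + t * x) by lra.
have ax : 0 < a ^+ 2 * x by rewrite mulr_gt0 ?exprn_gt0.
by rewrite normrN ger0_norm ?invr_ge0 ?lef_pV2 ?posrE; lra.
Qed.

Lemma mean_inv_gt0 : 0 < mean GRing.inv.
Proof.
apply: (@concentrated_gt0 _ _ _ _ _ mab H_ab _ a^-1) => //.
  exact: measurable_fun_inverse.
move=> t tab; have [a0 [ta tb]] := support tab.
rewrite invr_gt0; apply/andP; split; first by lra.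
by apply: le_trans (inv_bound tab); exact: ler_norm.
Qed.

End resolvent.

(** * Signal limits along the fixed-point equation *)

Lemma cvg_dist_le (R : realType) (T : Type) (F : set_system T) (FF : Filter F)
    (f e : T -> R) (l : R) :
  (\forall s \near F, `|f s - l| <= e s) -> e s @[s --> F] --> (0 : R) ->
  f s @[s --> F] --> l.
Proof.
move=> fe e0.
apply: (@squeeze_cvgr _ _ FF _ (fun s => l - e s) (fun s => l + e s)).
- apply: filterS fe => s; rewrite ler_norml => /andP[]; lra.
- by rewrite -[X in _ --> X]subr0; apply: cvgB => //; exact: cvg_cst.
- by rewrite -[X in _ --> X]addr0; apply: cvgD => //; exact: cvg_cst.
Qed.

Lemma cvgZ_inv_pinfty (R : realType) (c : R) :
  c * s^-1 @[s --> +oo] --> (0 : R).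
Proof.
rewrite -(mulr0 c); apply: cvgM; first exact: cvg_cst.
apply/gtr0_cvgV0; last exact: cvg_id.
exact: nbhs_pinfty_gt.
Qed.

(** The intermediate value theorem between 0, where the left-hand side is 1, and
    gamma / (a (gamma - 1)), where [resolvent_le] makes it nonpositive. *)
Lemma resolvent_root (R : realType) (H : probability (measurableTypeR R) R)
    (a b gamma : R) : 0 < a -> H `[a, b]%classic = 1%E -> 1 < gamma ->
  exists c, 0 < c /\ 1 - gamma + gamma * resolvent H a b c = 0.
Proof.
move=> a_gt0 H_ab gamma1.
pose f x := 1 - gamma + gamma * resolvent H a b x.
pose y := gamma / (a * (gamma - 1)).
have y_gt0 : 0 < y by rewrite divr_gt0 ?mulr_gt0; lra.
have f0 : f 0 = 1.
  have := resolvent_identity a_gt0 H_ab (lexx 0).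
  by rewrite mul0r add0r /f => ->; ring.
have fy : f y <= 0.
  have := resolvent_le a_gt0 H_ab y_gt0.
  rewrite (_ : (a * y)^-1 = (gamma - 1) / gamma); last first.
    by rewrite /y; field; apply/and3P; split; lra.
  rewrite -(ler_pM2l (_ : 0 < gamma)); last lra.
  by rewrite mulrCA divff ?mulr1 /f; lra.
have f_lip x z : 0 <= x -> 0 <= z -> `|f x - f z| <= gamma * b * `|x - z|.
  move=> x0 z0; rewrite /f opprD addrACA subrr add0r -mulrBr normrM.
  rewrite (ger0_norm (_ : 0 <= gamma)) -?mulrA ?ler_wpM2l//; try lra.
  exact: resolvent_lipschitz.
(* The Lipschitz bound holds for nonnegative arguments only; composing with the
   absolute value gives a function that is continuous on the whole line. *)
have cf : {within `[0, y], continuous (fun x => f `|x|)}.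
  apply: continuous_subspaceT => x.
  apply: (@cvg_dist_le _ _ _ _ _ (fun z => gamma * b * `|z - x|)).
    near=> z; apply: (le_trans (f_lip _ _ _ _)) => //.
    rewrite ler_wpM2l ?ler_dist_dist// mulr_ge0//; first by lra.
    exact/ltW/(support_sup_gt0 a_gt0 H_ab).
  have : gamma * b * `|z - x| @[z --> x] --> gamma * b * `|x - x|.
    apply: cvgM; first exact: cvg_cst.
    by apply: cvg_norm; apply: cvgB; [exact: cvg_id|exact: cvg_cst].
  by rewrite subrr normr0 mulr0.
have fv : Num.min (f `|0 : R|) (f `|y|) <= 0 <= Num.max (f `|0 : R|) (f `|y|).
  by rewrite normr0 f0 (gtr0_norm y_gt0) ge_min le_max fy ler01 orbT.
have [c /itvP c_itv fc] := IVT (ltW y_gt0) cf fv.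
have c0 : 0 <= c by rewrite c_itv.
move: fc; rewrite ger0_norm// => fc; exists c; split=> //.
rewrite lt_neqAle c0 andbT eq_sym; apply/eqP => c00.
by move: fc; rewrite c00 f0 => /eqP; rewrite oner_eq0.
Unshelve. all: end_near. Qed.

(** V s stands for v (- gamma / s), and V_eq is the Silverstein equation there,
    solved for the inverse of V s. *)
Section limits.
Context (R : realType) (H : probability (measurableTypeR R) R).
Context (a b gamma : R) (V : R -> R).
Context (a_gt0 : 0 < a) (H_ab : H `[a, b]%classic = 1%E).
Context (gamma_gt0 : 0 < gamma) (V_gt0 : forall s, 0 < s -> 0 < V s).
Context (V_eq : forall s, 0 < s ->
  (V s)^-1 = gamma / s + gamma * weighted_resolvent H a b (V s)).
Implicit Type s : R.

Definition risk s : R := (gamma / s * V s)^-1.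

Local Notation res := (resolvent H a b).
Local Notation wres := (weighted_resolvent H a b).

(** The Silverstein equation multiplied by V s, with [resolvent_identity]; the
    left-hand side is the inverse of the risk. *)
Lemma fixed_point s : 0 < s -> gamma / s * V s = 1 - gamma + gamma * res (V s).
Proof.
move=> s0; have V0 := V_gt0 s0.
have VV : V s * (V s)^-1 = 1 by rewrite divff ?gt_eqF.
move: VV; rewrite (V_eq s0) => VV.
have := resolvent_identity a_gt0 H_ab (ltW V0).
by move: VV; set A := wres _; set B := res _; nra.
Qed.

Lemma risk_eq s : 0 < s -> risk s = 1 + s * wres (V s).
Proof.
move=> s0; have := V_eq s0; have := V_gt0 s0; have g0 := gamma_gt0.
rewrite /risk invfM => V0 ->; field; apply/andP; split; lra.
Qed.

(** The integral term of the equation is nonnegative, so 1 / V s is at least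
    gamma / s. *)
Lemma V_le s : 0 < s -> V s <= s / gamma.
Proof.
move=> s0; have V0 := V_gt0 s0; have g0 := gamma_gt0.
have gs : 0 < gamma / s by rewrite divr_gt0.
rewrite -[leRHS]invf_div -[leLHS]invrK lef_pV2 ?posrE ?invr_gt0//.
rewrite (V_eq s0) lerDl mulr_ge0 ?(ltW g0)//.
exact: weighted_resolvent_ge0 (ltW V0).
Qed.

Lemma weak_signal_slope :
  ((risk s - 1) / s) @[s --> 0^'+] --> mean H a b id.
Proof.
apply: (@cvg_dist_le _ _ _ _ _ (fun s => b ^+ 2 / gamma * s)).
  near=> s; have s0 : 0 < s by [].
  have -> : (risk s - 1) / s = wres (V s) by rewrite risk_eq//; field; lra.
  apply: le_trans (weighted_resolvent_near0 a_gt0 H_ab (ltW (V_gt0 s0))) _.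
  by rewrite -mulrA ler_wpM2l ?sqr_ge0// mulrC V_le.
have : b ^+ 2 / gamma * s @[s --> 0^'+] --> b ^+ 2 / gamma * 0.
  apply: cvgM; first exact: cvg_cst.
  by apply: cvg_at_right_filter; exact: cvg_id.
by rewrite mulr0.
Unshelve. all: end_near. Qed.

Lemma weak_signal : risk s @[s --> 0^'+] --> (1 : R).
Proof.
have -> : (1 : R) = 1 + 0 * mean H a b id by rewrite mul0r addr0.
have : (1 + s * ((risk s - 1) / s)) @[s --> 0^'+] -->
    (1 + 0 * mean H a b id : R).
  apply: cvgD; first exact: cvg_cst.
  apply: cvgM; last exact: weak_signal_slope.
  by apply: cvg_at_right_filter; exact: cvg_id.
apply: cvg_trans; apply: near_eq_cvg; near=> s.
have s0 : 0 < s by [].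
by rewrite mulrCA divff ?gt_eqF// mulr1 addrC subrK.
Unshelve. all: end_near. Qed.

Lemma strong_signal_lt1 : gamma < 1 -> risk s @[s --> +oo] --> (1 - gamma)^-1.
Proof.
move=> g1; apply: cvgV; first by rewrite subr_eq0 gt_eqF.
apply: (@cvg_dist_le _ _ _ _ _
  (fun s => gamma ^+ 2 / (a * (1 - gamma)) * s^-1)); last first.
  exact: cvgZ_inv_pinfty.
near=> s; have s0 : 0 < s by [].
have V0 := V_gt0 s0; have g0 := gamma_gt0; have a0 := a_gt0.
have fp := fixed_point s0.
have res0 : 0 <= res (V s) := ltW (resolvent_gt0 a_gt0 H_ab (ltW V0)).
rewrite fp addrC addKr ger0_norm ?mulr_ge0//; last lra.
(* The right-hand side of the fixed-point equation is at least 1 - gamma. *)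
have Vs : (1 - gamma) * s <= gamma * V s.
  have -> : gamma * V s = gamma / s * V s * s by field; lra.
  by rewrite ler_pM2r// fp; nra.
have := resolvent_le a_gt0 H_ab V0; rewrite invfM => resle.
rewrite -(ler_pM2l (_ : 0 < gamma)) in resle; last lra.
apply: (le_trans resle).
have -> : gamma ^+ 2 / (a * (1 - gamma)) / s =
    gamma * (a^-1 * ((1 - gamma) * s / gamma)^-1).
  by field; do ! (apply/andP; split); lra.
rewrite ler_wpM2l ?ler_wpM2l ?invr_ge0//; try lra.
rewrite lef_pV2 ?posrE// ?divr_gt0 ?mulr_gt0//; try lra.
by rewrite ler_pdivrMr//; lra.
Unshelve. all: end_near. Qed.

Lemma strong_signal_gt1 (v0 : R) : 0 < v0 -> 1 - gamma + gamma * res v0 = 0 ->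
  (s^-1 * risk s) @[s --> +oo] --> (gamma * v0)^-1.
Proof.
move=> v0_gt0 v0_eq; have g0 := gamma_gt0; have a0 := a_gt0.
have -> : (fun s => s^-1 * risk s) = (fun s => s^-1 * risk s) by [].
have Vcvg : (gamma * V s) @[s --> +oo] --> gamma * v0.
  apply: cvgM; first exact: cvg_cst.
  apply: (@cvg_dist_le _ _ _ _ _
    (fun s => v0 * (a / (1 + b * v0) ^+ 2)^-1 * s^-1)); last first.
    exact: cvgZ_inv_pinfty.
  near=> s; have s0 : 0 < s by [].
  have V0 := V_gt0 s0; have fp := fixed_point s0.
  have lv0 : 0 < gamma / s * V s by rewrite mulr_gt0 ?divr_gt0.
(* Beyond v0 the right-hand side of the fixed-point equation would be
     nonpositive. *)
  have [Vv|/ltW vV] := leP (V s) v0; last first.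
    have := resolvent_decr a_gt0 H_ab (ltW v0_gt0) vV.
    have bV : 0 < a / (1 + b * V s) ^+ 2.
      rewrite divr_gt0 ?exprn_gt0 ?addr_gt0 ?mulr_gt0//.
      exact: support_sup_gt0 a_gt0 H_ab.
    move=> decr; have : 0 <= res v0 - res (V s).
      by apply: le_trans decr; rewrite mulr_ge0; lra.
    by nra.
  have := resolvent_decr a_gt0 H_ab (ltW V0) Vv.
  set k := a / _; have k0 : 0 < k.
    rewrite divr_gt0 ?exprn_gt0 ?addr_gt0 ?mulr_gt0//.
    exact: support_sup_gt0 a_gt0 H_ab.
  move=> decr; rewrite distrC ger0_norm ?subr_ge0//.
  have -> : v0 * k^-1 / s = (v0 / s) / k by ring.
  rewrite ler_pdivlMr// mulrC; apply: le_trans decr _.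
  rewrite -(ler_pM2l g0).
  apply: (@le_trans _ _ (gamma / s * V s)); first by lra.
  by rewrite mulrAC -mulrA ler_wpM2l ?ler_wpM2r ?invr_ge0; lra.
have : (gamma * V s)^-1 @[s --> +oo] --> (gamma * v0)^-1.
  by apply: cvgV => //; rewrite gt_eqF ?mulr_gt0.
apply: cvg_trans; apply: near_eq_cvg; near=> s.
have s0 : 0 < s by [].
have V0 := V_gt0 s0.
by rewrite /risk; field; do ! (apply/andP; split); lra.
Unshelve. all: end_near. Qed.

Lemma strong_signal_eq1 : gamma = 1 ->
  ((Num.sqrt s)^-1 * risk s) @[s --> +oo] -->
    (Num.sqrt (mean H a b GRing.inv))^-1.
Proof.
move=> g1; have m0 := mean_inv_gt0 a_gt0 H_ab.
have Vcvg : (V s ^+ 2 / s) @[s --> +oo] --> mean H a b GRing.inv.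
  apply: (@cvg_dist_le _ _ _ _ _
    (fun s => (a ^+ 2)^-1 * Num.sqrt ((1 + b) * s^-1))); last first.
    rewrite -(mulr0 (a ^+ 2)^-1); apply: cvgM; first exact: cvg_cst.
    rewrite -(sqrtr0 R); apply: cvg_comp (cvgZ_inv_pinfty _) _.
    exact: sqrt_continuous.
  near=> s; have s1 : 1 + b < s.
    by near: s; apply: nbhs_pinfty_gt; exact: num_real.
  have b0 := support_sup_gt0 a_gt0 H_ab.
  have s0 : 0 < s by lra.
  have V0 := V_gt0 s0; have fp := fixed_point s0.
  have VV : V s ^+ 2 / s = V s * res (V s).
    have -> : res (V s) = 1 / s * V s by move: fp; rewrite g1; lra.
    by field; lra.
  rewrite VV; apply: (le_trans (resolvent_nearpinfty a_gt0 H_ab V0)).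
  rewrite invfM ler_wpM2l ?invr_ge0 ?sqr_ge0//.
(* V s grows at least like the square root of s. *)
  have sV : s <= V s * (1 + b * V s).
    have := resolvent_ge a_gt0 H_ab (ltW V0).
    have -> : res (V s) = V s / s by move: fp; rewrite g1; lra.
    rewrite ler_pdivlMr// mulrC ler_pdivrMr//.
    by rewrite addr_gt0 ?mulr_gt0.
  have V1 : 1 <= V s.
    rewrite leNgt; apply/negP => V1.
    have bV : b * V s <= b by rewrite -[leRHS]mulr1 ler_wpM2l// ltW.
    have : V s * (1 + b * V s) <= 1 * (1 + b).
      by rewrite ler_pM ?addr_ge0 ?mulr_ge0//; lra.
    lra.
  have sV2 : s <= (1 + b) * V s ^+ 2 by nra.
  rewrite -[leLHS]ger0_norm ?invr_ge0 ?(ltW V0)// -sqrtr_sqr ler_wsqrtr//.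
  by rewrite exprVn ler_pdivlMr// mulrC ler_pdivrMr ?exprn_gt0.
have : (Num.sqrt (V s ^+ 2 / s))^-1 @[s --> +oo] -->
    (Num.sqrt (mean H a b GRing.inv))^-1.
  apply: cvgV; first by rewrite gt_eqF ?sqrtr_gt0.
  by apply: cvg_comp Vcvg _; exact: sqrt_continuous.
apply: cvg_trans; apply: near_eq_cvg; near=> s.
have s0 : 0 < s by [].
have V0 := V_gt0 s0.
rewrite /risk g1 sqrtrM ?sqr_ge0// sqrtr_sqr gtr0_norm// sqrtrV ?ltW//.
have ss0 : 0 < Num.sqrt s by rewrite sqrtr_gt0.
rewrite (_ : 1 / s = (Num.sqrt s ^+ 2)^-1); last first.
  by rewrite sqr_sqrtr ?div1r// ltW.
by field; do ! (apply/andP; split); lra.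
Unshelve. all: end_near. Qed.

End limits.

(** * The companion Stieltjes transform on the negative half line *)

(** Compactness puts a least and a greatest element in K, and the least one is
    positive. *)
Lemma compact_support_itv (R : realType) (H : probability (measurableTypeR R) R)
    (K : set R) : compact K -> K `<=` [set t | 0 < t] -> H K = 1%E ->
  exists a b, 0 < a /\ H `[a, b]%classic = 1%E.
Proof.
move=> cK K_gt0 HK.
have K0 : K !=set0.
  apply/set0P/eqP => K0; move: HK; rewrite K0 measure0 => /esym/eqP.
  by rewrite onee_eq0.
have idc : {within K, continuous (fun x : R => x)}.
  by apply: continuous_subspaceT => x; exact: cvg_id.
have [a aK Ka] := compact_EVT_min K0 cK idc.
have [b bK Kb] := compact_EVT_max K0 cK idc.
exists a, b; split; first exact/K_gt0/set_mem.
apply/eqP; rewrite eq_le probability_le1 ?measurable_itv//= -HK.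
rewrite le_measure ?inE//; first exact: compact_measurable.
by move=> t /mem_set tK; rewrite /= in_itv/= Ka// Kb.
Qed.

(** The atom at 0 does not charge the negative half line, whatever the sign of
    its weight 1 - gamma. *)
Lemma companion_half_line (R : realType) (gamma : R)
    (F Fbar : probability (measurableTypeR R) R) :
  companion_distribution gamma F Fbar -> F `]-oo, 0[%classic = 0%E ->
  Fbar `[0, +oo[%classic = 1%E.
Proof.
move=> Fbar_def F0; rewrite -setCitvl probability_setC//.
have -> : Fbar `]-oo, 0[%classic = 0%E.
  rewrite Fbar_def// F0 mule0 add0e /dirac indicE memNset ?mule0//.
  by rewrite /= in_itv/= ltxx.
by rewrite sube0.
Qed.

Lemma Cintegral_real (R : realType) (mu : probability (measurableTypeR R) R)
    (f : R -> R) :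
  Cintegral mu (fun t => ((f t)%:C)%C) = ((\int[mu]_t f t)%:C)%C.
Proof. by rewrite /Cintegral/= Rintegral_cst// mul0r. Qed.

Lemma stieltjes_real (R : realType) (mu : probability (measurableTypeR R) R)
    (l : R) : stieltjes mu ((- l)%:C)%C = ((\int[mu]_x (x + l)^-1)%:C)%C.
Proof.
rewrite -Cintegral_real /stieltjes; congr Cintegral; apply/funext => x.
by rewrite -rmorphB opprK -fmorphV.
Qed.

Lemma stieltjes_gt0 (R : realType) (mu : probability (measurableTypeR R) R)
    (l : R) : mu `[0, +oo[%classic = 1%E -> 0 < l ->
  0 < \int[mu]_x (x + l)^-1.
Proof.
move=> mu1 l0.
have mD : measurable (`[0, +oo[%classic : set (measurableTypeR R)).
  by exact: measurable_itv.
have mf : measurable_fun setT (fun x : R => (x + l)^-1).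
  by apply: measurable_fun_inverse; apply: measurable_funD.
have f0 (t : R) : `[0, +oo[%classic t -> 0 < (t + l)^-1 <= l^-1.
  rewrite /= in_itv/= andbT => t0.
  by rewrite invr_gt0 lef_pV2 ?posrE; lra.
rewrite (@concentrated_Rintegral _ _ _ _ _ mD mu1 _ _ l^-1)//.
  exact: (@concentrated_gt0 _ _ _ _ _ mD mu1 _ l^-1).
by move=> t /f0 /andP[t1 t2]; rewrite gtr0_norm.
Qed.

Lemma silverstein_real (R : realType) (gamma : R)
    (H Fbar : probability (measurableTypeR R) R) (l : R) :
  let v := \int[Fbar]_x (x + l)^-1 in
  silverstein_equation gamma H (stieltjes Fbar) -> 0 < l ->
  v^-1 = l + gamma * \int[H]_t (t / (1 + t * v)).
Proof.
move=> v silverstein l0.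
have : off_half_line ((- l)%:C)%C by move=> x x0 /complexI; lra.
move=> /silverstein; rewrite stieltjes_real -/v.
have -> : (fun t : R => (t%:C / (1 + t%:C * v%:C))%C) =
    (fun t => ((t / (1 + t * v))%:C)%C).
  by apply/funext => t; rewrite fmorph_div rmorphD rmorphM rmorph1.
rewrite Cintegral_real -fmorphV -rmorphM -rmorphN -rmorphB => /complexI.
lra.
Qed.

Lemma optimal_risk_real (R : realType) (gamma : R)
    (Fbar : probability (measurableTypeR R) R) :
  optimal_risk gamma (stieltjes Fbar) =
  risk gamma (fun s => \int[Fbar]_x (x + gamma / s)^-1).
Proof.
by apply/funext => s; rewrite /optimal_risk stieltjes_real -rmorphM -fmorphV.
Qed.

(** Rewrites the equation that characterizes v(0) in terms of the resolvent
    mean, which is strictly decreasing. *)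
Lemma resolvent_companion (R : realType) (H : probability (measurableTypeR R) R)
    (a b c : R) : 0 < a -> H `[a, b]%classic = 1%E -> 0 <= c ->
  \int[H]_(t in `[0, +oo[) (t * c / (1 + t * c)) = 1 - resolvent H a b c.
Proof.
move=> a0 H_ab c0.
have -> : 1 - resolvent H a b c = c * weighted_resolvent H a b c.
  by have := resolvent_identity a0 H_ab c0; lra.
have mab : measurable (`[a, b]%classic : set (measurableTypeR R)).
  by exact: measurable_itv.
have sub : `[a, b]%classic `<=` `[0, +oo[%classic.
  move=> t; rewrite /= !in_itv/= => /andP[at_ _].
  by rewrite andbT (le_trans (ltW a0)).
have bound (t : R) : `[a, b]%classic t -> `|t / (1 + t * c)| <= b.
  by move=> tab; exact: weighted_resolvent_bound tab c0.
have mf := measurable_weighted_resolvent (R := R) c.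
have fi := concentrated_integrable mab H_ab mf bound.
under eq_Rintegral do rewrite mulrAC mulrC.
rewrite RintegralZl//; last first.
  exact: integrableS fi.
by rewrite (concentrated_Rintegral mab H_ab mf bound).
Qed.

(** * The limiting risk *)

Unset Implicit Arguments.

Theorem mainTheorem3 (R : realType)
    (gamma : R) (gamma_gt0 : 0 < gamma)
    (H : probability (measurableTypeR R) R)
    (H_supp : exists K : set R,
      [/\ compact K, K `<=` [set t | 0 < t] & H K = 1%E])
    (* the random matrices and their limiting spectral distribution *)
    (d : measure_display) (Omega : measurableType d) (P : probability Omega R)
    (n p : nat -> nat) (Sigma : forall k, 'M[R]_(p k))
    (Z : forall k, 'I_(n k) -> 'I_(p k) -> {RV P >-> R})
    (model : sample_covariance_model gamma H Sigma Z)
    (F Fbar : probability (measurableTypeR R) R)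
    (F_lim : limiting_spectral_distribution Sigma Z F)
    (Fbar_def : companion_distribution gamma F Fbar)
    (* the Silverstein equation for the companion Stieltjes transform *)
    (silverstein : silverstein_equation gamma H (stieltjes Fbar)) :
  let Rstar := optimal_risk gamma (stieltjes Fbar) in
  [/\ (* weak signal *)
      Rstar s @[s --> 0^'+] --> (1 : R) /\
      ((Rstar s - 1) / s) @[s --> 0^'+] --> fine ('E_H[(fun t : R => t)])%E,
      (* strong signal *)
      gamma < 1 -> Rstar s @[s --> +oo] --> (1 - gamma)^-1,
      1 < gamma -> exists v0 : R,
        unique (fun c : R => 0 < c /\
          gamma^-1 = \int[H]_(t in `[0, +oo[) (t * c / (1 + t * c))) v0 /\
        (s^-1 * Rstar s) @[s --> +oo] --> (gamma * v0)^-1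
    & gamma = 1 ->
        ((Num.sqrt s)^-1 * Rstar s) @[s --> +oo] -->
          (Num.sqrt (fine ('E_H[((fun t : R => t^-1)%R)])%E))^-1].
Proof.
move=> Rstar.
have [K [K_compact K_gt0 HK]] := H_supp.
have [a [b [a0 H_ab]]] := compact_support_itv K_compact K_gt0 HK.
have g0 := gamma_gt0.
have mab : measurable (`[a, b]%classic : set (measurableTypeR R)).
  by exact: measurable_itv.
have Fbar1 := companion_half_line Fbar_def (lsd_lt0 F_lim).
pose V s := \int[Fbar]_x (x + gamma / s)^-1.
have V_gt0 s : 0 < s -> 0 < V s.
  by move=> s0; apply: stieltjes_gt0 => //; rewrite divr_gt0.
have V_eq s : 0 < s ->
    (V s)^-1 = gamma / s + gamma * weighted_resolvent H a b (V s).
  move=> s0; have V0 := V_gt0 _ s0.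
  rewrite (silverstein_real silverstein) ?divr_gt0// -/(V s).
  rewrite (concentrated_Rintegral mab H_ab (M := b))//.
    exact: measurable_weighted_resolvent.
  by move=> t tab; exact: weighted_resolvent_bound tab (ltW V0).
have -> : Rstar = risk gamma V by exact: optimal_risk_real.
have mean_id : fine ('E_H[(fun t : R => t)])%E = mean H a b id.
  rewrite unlock; apply: (concentrated_Rintegral mab H_ab (M := b)) => //.
  move=> t /=; rewrite in_itv/= => /andP[at_ tb].
  by rewrite ger0_norm//; lra.
have mean_inv : fine ('E_H[((fun t : R => t^-1)%R)])%E = mean H a b GRing.inv.
  rewrite unlock; apply: (concentrated_Rintegral mab H_ab (M := a^-1)) => //.
    exact: measurable_fun_inverse.
  by move=> t tab; exact: inv_bound tab.
rewrite mean_id mean_inv; split.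
- split; first exact: weak_signal a0 H_ab g0 V_gt0 V_eq.
  exact: weak_signal_slope a0 H_ab g0 V_gt0 V_eq.
- exact: strong_signal_lt1 a0 H_ab g0 V_gt0 V_eq.
- move=> g1; have [v0 [v0_gt0 v0_eq]] := resolvent_root a0 H_ab g1.
  exists v0; split; last first.
    exact: (strong_signal_gt1 a0 H_ab g0 V_gt0 V_eq v0_gt0 v0_eq).
  have rootE c : 0 < c ->
      gamma^-1 = \int[H]_(t in `[0, +oo[) (t * c / (1 + t * c)) <->
      resolvent H a b c = 1 - gamma^-1.
    move=> c0; rewrite (resolvent_companion a0 H_ab (ltW c0)).
    by split=> ?; lra.
  have v0E : resolvent H a b v0 = 1 - gamma^-1.
    apply: (mulfI (lt0r_neq0 g0)); rewrite mulrBr divff ?gt_eqF//; lra.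
  split; first by split=> //; apply/rootE.
  move=> c [c0 /(rootE _ c0) cE].
  by apply: (resolvent_inj a0 H_ab (ltW v0_gt0) (ltW c0)); rewrite v0E cE.
- exact: (strong_signal_eq1 a0 H_ab V_gt0 V_eq).
Qed.
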